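(* Let $G=(V,E,\omega)$ be a finite undirected weighted graph with graph Laplacian $L=U\Lambda U^T$, where $U$ is a real orthogonal matrix and $\Lambda$ is diagonal. Let $\hat w:V\to\mathbb{R}$ be a convolution kernel such that $$\hat w_i\in[0,2)\quad\text{for all } i.$$ Let $s_0:V\to\mathbb{R}$ and define the sequence $\{s_m\}_{m\ge0}$ by $$s_{m+1}=s_m-U\left(\hat w\odot (U^Ts_m)\right)\quad\text{for all } m\ge 0.$$ Then $\{s_m\}$ converges as $m\to\infty$ to $$s_\infty = w^{(\infty)}\circledast s_0,$$ where $w^{(\infty)}=U\hat w^{(\infty)}$ and $\hat w^{(\infty)}$ is defined by $$\hat w^{(\infty)}_i=\begin{cases}1 & \text{if } \hat w_i=0,\\ 0 & \text{if } 0<\hat w_i<2.\end{cases}$$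
   Context: An undirected weighted graph $G=(V,E,\omega)$ consists of a finite vertex set $V$, a set $E$ of unordered pairs of vertices, and a weight function $\omega:E\to\mathbb{R}$. Its adjacency matrix is $A_{i,j}=\omega(i,j)$ if $(i,j)\in E$ and $A_{i,j}=0$ otherwise; its degree matrix $D$ is diagonal with $D_{i,i}=\sum_{j\in V}A_{i,j}$; its graph Laplacian is the real symmetric matrix $L=D-A$. Fix an orthogonal $U$ and a diagonal $\Lambda$ with $L=U\Lambda U^T$. Signals $s:V\to\mathbb{R}$ are identified with vectors in $\mathbb{R}^{|V|}$. The Graph Fourier Transform is $\hat s=\mathrm{GFT}(s)=U^Ts$ and its inverse is $\mathrm{IGFT}(\hat s)=U\hat s$. The graph convolution of $s,v:V\to\mathbb{R}$ is $s\circledast v=U\left[(U^Ts)\odot(U^Tv)\right]$, where $\odot$ is the entrywise (Hadamard) product. The recursion in the claim, equivalently $s_{m+1}=s_m-s_m\circledast w$ with $w=U\hat w$, is the inner loop of the Graph Fourier Transform Iterative Filtering (GFT-IF) algorithm, run indefinitely. *)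

(* Defs.v *)
From mathcomp Require Import all_boot all_order all_algebra.
From mathcomp Require Import reals.

Set Implicit Arguments.
Unset Strict Implicit.
Unset Printing Implicit Defensive.

Import Order.TTheory GRing.Theory Num.Theory.
Local Open Scope ring_scope.

(* The unordered pair {u, v} is the set [set u; v]; u = v (a loop) is allowed,
   and the weights may have any sign. *)
Record weighted_graph (R : realType) (V : finType) := WeightedGraph {
  edges : {set {set V}};
  edges_pair : forall e, e \in edges -> exists u v : V, e = [set u; v];
  weight : {e : {set V} | e \in edges} -> R
}.

(* Matrices and signals over V are indexed by 'I_#|V|, the index i standing for
   the vertex enum_val i. *)
Definition adjacency (R : realType) (V : finType) (G : weighted_graph R V) :
    'M[R]_#|V| :=
  \matrix_(i, j) oapp (@weight R V G) 0 (insub [set enum_val i; enum_val j]).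

Definition degree (R : realType) (V : finType) (G : weighted_graph R V) :
    'M[R]_#|V| :=
  diag_mx (\row_i \sum_j adjacency G i j).

Definition laplacian (R : realType) (V : finType) (G : weighted_graph R V) :
    'M[R]_#|V| :=
  degree G - adjacency G.

Definition orthogonal_mx (R : realType) (n : nat) (U : 'M[R]_n) : Prop :=
  U *m U^T = 1%:M /\ U^T *m U = 1%:M.

Definition hadamard (R : realType) (n : nat) (x y : 'cV[R]_n) : 'cV[R]_n :=
  map2_mx *%R x y.

Definition gft (R : realType) (n : nat) (U : 'M[R]_n) (s : 'cV[R]_n) :
    'cV[R]_n :=
  U^T *m s.

Definition igft (R : realType) (n : nat) (U : 'M[R]_n) (s : 'cV[R]_n) :
    'cV[R]_n :=
  U *m s.

Definition gconv (R : realType) (n : nat) (U : 'M[R]_n) (s v : 'cV[R]_n) :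
    'cV[R]_n :=
  igft U (hadamard (gft U s) (gft U v)).

(* Only used for kernels with entries in [0, 2), so that the last branch is the
   case 0 < what i 0 < 2. *)
Definition limit_kernel (R : realType) (n : nat) (what : 'cV[R]_n) :
    'cV[R]_n :=
  \col_i (if what i 0 == 0 then 1 else 0).

(* Main.v *)
Require Import Defs.
From mathcomp Require Import all_boot all_order all_algebra.
From mathcomp Require Import all_classical all_reals all_analysis.

Import Order.TTheory GRing.Theory Num.Theory.
Import numFieldNormedType.Exports.
Local Open Scope classical_set_scope.
Local Open Scope ring_scope.

(** Orthogonality of [U] diagonalises the recursion: in the Fourier domain
    the [i]-th coefficient is multiplied by [1 - what i] at each step.  Since
    [what i] lies in [[0, 2)], either this factor is [1] and the coefficient is
    constant, or its absolute value is less than [1] and the coefficient tends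
    to [0].  Applying the continuous map [U] gives the limit of the signals. *)

(** A basic neighbourhood of [M] is a box of neighbourhoods of its entries; there are finitely many
    entries, so along [F] all the entrywise constraints eventually hold at once. *)
Lemma cvg_mx {T : Type} {K : topologicalType} {m n : nat} {F : set_system T}
    {FF : Filter F} (f : T -> 'M[K]_(m, n)) (M : 'M[K]_(m, n)) :
  (forall i j, f x i j @[x --> F] --> M i j) -> f x @[x --> F] --> M.
Proof.
move=> fM A [P MP PA].
have fP : \forall x \near F, forall i j, P i j (f x i j).
  by apply: filter_forall => i; apply: filter_forall => j; exact/fM/MP.
by apply: filterS fP => x Px; exact: PA.
Qed.

Lemma cvg_sum {T : Type} {K : numFieldType} {I : Type} {F : set_system T}
    {FF : Filter F} (r : seq I) (f : I -> T -> K) (l : I -> K) :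
  (forall i, f i x @[x --> F] --> l i) ->
  \sum_(i <- r) f i x @[x --> F] --> \sum_(i <- r) l i.
Proof.
move=> fl; elim: r => [|i r IHr].
  by under eq_fun do rewrite big_nil; rewrite big_nil; exact: cvg_cst.
under eq_fun do rewrite big_cons.
by rewrite big_cons; exact: cvgD (fl i) IHr.
Qed.

(** Each entry of [A *m f x] is a finite sum of constant multiples of entries of [f x]. *)
Lemma cvg_mulmxl {T : Type} {K : numFieldType} {m n p : nat}
    {F : set_system T} {FF : Filter F} (A : 'M[K]_(m, n))
    (f : T -> 'M[K]_(n, p)) (M : 'M[K]_(n, p)) :
  (forall i j, f x i j @[x --> F] --> M i j) ->
  A *m f x @[x --> F] --> A *m M.
Proof.
move=> fM; apply: cvg_mx => i j.
under eq_fun do rewrite mxE.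
by rewrite mxE; apply: cvg_sum => k; exact: cvgMr (fM k j).
Qed.

Lemma gft_filter_iter {R : realType} {n : nat} (U : 'M[R]_n)
    (what : 'cV[R]_n) (s : nat -> 'cV[R]_n) :
  U^T *m U = 1%:M ->
  (forall m, s m.+1 = s m - U *m hadamard what (U^T *m s m)) ->
  forall m i, gft U (s m) i 0 = (1 - what i 0) ^+ m * gft U (s 0%N) i 0.
Proof.
rewrite /gft => UTU s_rec m i; elim: m => [|m IHm]; first by rewrite mul1r.
(* Transforming the recursion cancels [U] and leaves an entrywise product. *)
rewrite s_rec mulmxBr mulmxA UTU mul1mx [LHS]mxE [X in _ + X]mxE /hadamard.
by rewrite [X in _ - X]mxE IHm exprS -mulrA mulrBl mul1r.
Qed.

Lemma cvg_expr_1B {R : realType} (w : R) : 0 <= w < 2 ->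
  (1 - w) ^+ m @[m --> \oo] --> (if w == 0 then 1 else 0 : R).
Proof.
move=> /andP[w_ge0 w_lt2]; case: eqVneq => [->|w_neq0].
  by under eq_fun do rewrite subr0 expr1n; exact: cvg_cst.
(* Here [0 < w < 2], that is [-1 < 1 - w < 1]. *)
apply: cvg_expr; rewrite ltr_norml ltrBrDr ltrBlDr ltrDl lt0r w_neq0 w_ge0.
by rewrite addrC ltrBlDr !andbT -[1 + 1]/2.
Qed.

Theorem theorem2 (R : realType) (V : finType) (G : weighted_graph R V)
    (U Lambda : 'M[R]_#|V|)
    (U_orth : orthogonal_mx U)
    (Lambda_diag : is_diag_mx Lambda)
    (L_eq : laplacian G = U *m Lambda *m U^T)
    (what : 'cV[R]_#|V|)
    (what_range : forall i, 0 <= what i 0 < 2)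
    (s0 : 'cV[R]_#|V|)
    (s : nat -> 'cV[R]_#|V|)
    (s_init : s 0%N = s0)
    (s_rec : forall m, s m.+1 = s m - U *m hadamard what (U^T *m s m)) :
  s m @[m --> \oo] --> gconv U (igft U (limit_kernel what)) s0.
Proof.
have [UUT UTU] := U_orth.
(* Each signal is the inverse transform of its transform, so only the Fourier coefficients need a
   limit. *)
have -> : s = fun m => U *m gft U (s m).
  by apply/funext => m; rewrite /gft mulmxA UUT mul1mx.
apply: cvg_mulmxl => i j; rewrite ord1 {j}.
(* In the limit too, [U^T] cancels [U]: the target coefficient is [limit_kernel what i 0] times that
   of [s0]. *)
rewrite /igft [gft U (U *m _)]mulmxA UTU mul1mx.
rewrite [X in _ --> X]mxE [limit_kernel _ _ _]mxE.
under eq_fun do rewrite (gft_filter_iter _ _ _ UTU s_rec) s_init.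
by apply: cvgMl; exact: cvg_expr_1B.
Qed.
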